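(* Let $q$ be a prime power and let $\mathcal{C}\subseteq \mathrm{U}(n,\mathbb{F}_q)$ be an MFRD code with minimum distance $\delta=3$. If \[ n=\frac{q^3-1}{q-1}, \] then $\mathcal{C}$ is perfect.
   Context: $\mathbb{F}_q$ is the finite field with $q$ elements. $\mathrm{U}(n,\mathbb{F}_q)$ is the $\mathbb{F}_q$-vector space of $n\times n$ upper triangular matrices over $\mathbb{F}_q$; it has dimension $\frac{n(n+1)}{2}$. For $M\in \mathrm{U}(n,\mathbb{F}_q)$ and $1\le i\le n$, $M_{[i]}$ is the $i\times(n-i+1)$ submatrix of $M$ obtained by deleting the first $i-1$ columns and the last $n-i$ rows (i.e. rows $1,\dots,i$ and columns $i,\dots,n$). The flag-rank weight of $M$ is $\mathrm{fr}(M)=\sum_{i=1}^{n}\mathrm{rk}(M_{[i]})$; the flag-rank distance is $\mathrm{d}_{\mathrm{fr}}(A,B)=\mathrm{fr}(A-B)$. A linear flag-rank-metric code is an $\mathbb{F}_q$-subspace $\mathcal{C}$ of $\mathrm{U}(n,\mathbb{F}_q)$; its minimum (flag-rank) distance, defined when $\mathcal{C}\neq\{\boldsymbol{0}\}$, is $\delta=\min\{\mathrm{fr}(M):M\in\mathcal{C}\setminus\{\boldsymbol{0}\}\}$. Its codimension is $\frac{n(n+1)}{2}-\dim_{\mathbb{F}_q}(\mathcal{C})$. Every linear flag-rank-metric code with minimum distance $\delta$ satisfies the (known) Singleton-like bound \[ \mathrm{codim}_{\mathbb{F}_q}(\mathcal{C})\ge \delta-1+\left\lfloor\sqrt{\delta-1}\right\rfloor\left\lfloor\frac{\sqrt{4(\delta-1)+1}-1}{2}\right\rfloor,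 \] and a linear flag-rank-metric code is called an MFRD (maximum flag-rank-distance) code if it attains this bound with equality. Let $b_q(n,t)=|\{A\in \mathrm{U}(n,\mathbb{F}_q):\mathrm{fr}(A)\le t\}|$. A code $\mathcal{C}$ with minimum distance $\delta$ is perfect if $|\mathcal{C}|\,b_q(n,t)=q^{\frac{n(n+1)}{2}}$, where $t=\left\lfloor\frac{\delta-1}{2}\right\rfloor$. *)

(* Defs.v *)
From HB Require Import structures.
From mathcomp Require Import all_boot all_order all_algebra all_field.

Set Implicit Arguments.
Unset Strict Implicit.
Unset Printing Implicit Defensive.

Import Order.TTheory GRing.Theory Num.Theory.
Local Open Scope ring_scope.

Section FlagRank.

Variables (F : finFieldType) (n : nat).
Implicit Types (M : 'M[F]_n) (C : {vspace 'M[F]_n}).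

(* [is_trig_mx] is lower triangularity. *)
Definition upper_trig M : bool := is_trig_mx M^T.

(* Indices start at 0 here: for i : 'I_n this is the block of rows 0, ..., i
   and columns i, ..., n - 1, that is, M_[i+1] with indices starting at 1. *)
Definition flag_submx M (i : 'I_n) : 'M[F]_(i.+1, n - i) :=
  mxsub (widen_ord (ltn_ord i))
        (fun j => cast_ord (subnKC (ltnW (ltn_ord i))) (rshift i j)) M.

Definition flag_rank M : nat := (\sum_(i < n) \rank (flag_submx M i))%N.

Definition fr_code C : Prop := forall M, M \in C -> upper_trig M.

(* No d satisfies this when C = 0. *)
Definition min_distance C (d : nat) : Prop :=
  (exists M, [/\ M \in C, M != 0 & flag_rank M = d])
  /\ (forall M, M \in C -> M != 0 -> (d <= flag_rank M)%N).

(* dim U(n, F) *)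
Definition dimU : nat := ((n * n.+1) %/ 2)%N.

Definition codim C : int := dimU%:Z - (\dim C)%:Z.

(* The square roots are taken in algC; for d >= 1 the arguments of sqrtC and
   of Num.floor are nonnegative reals, so these are the usual real root and
   floor. *)
Definition singleton_bound (d : nat) : int :=
  d%:Z - 1
  + Num.floor (sqrtC (d%:R - 1 : algC))
    * Num.floor ((sqrtC (4 * (d%:R - 1) + 1 : algC) - 1) / 2).

Definition MFRD C : Prop :=
  fr_code C /\ exists2 d, min_distance C d & codim C = singleton_bound d.

Definition fr_ball_card (t : nat) : nat :=
  #|[set A : 'M[F]_n | upper_trig A & (flag_rank A <= t)%N]|.

Definition perfect C : Prop :=
  fr_code C /\
  exists2 d, min_distance C d
           & (#|C| * fr_ball_card ((d - 1) %/ 2) = #|F| ^ dimU)%N.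

End FlagRank.

(* Main.v *)
(** A nonzero entry at position [(i, j)], [i <= j], makes every block from the
    [i]-th to the [j]-th nonzero, so the matrices of flag-rank weight at most 1
    are the [c E_ii].  Hence the ball of radius 1 has [1 + n (q - 1)] elements,
    which is [q ^ 3] for the given [n], while the Singleton-like bound at
    [delta = 3] is 3. *)
Require Import Defs.
From mathcomp Require Import all_boot all_order all_algebra all_field.

Import GRing.Theory Num.Theory.

Section FlagRankBall.

Local Open Scope ring_scope.
Variables (F : finFieldType) (n : nat).
Implicit Types (M : 'M[F]_n) (i j k : 'I_n).

(** The entry [M i j] sits in block [k] at row [i] and column [j - k]. *)
Lemma flag_submx_neq0 M i j k :
  M i j != 0 -> (i <= k)%N -> (k <= j)%N -> flag_submx M k != 0.
Proof.
move=> Mij le_ik le_kj.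
have lt_jk : (j - k < n - k)%N by rewrite ltn_sub2r // (leq_ltn_trans le_kj).
apply: contraNneq Mij.
move/matrixP/(_ (Ordinal (le_ik : (i < k.+1)%N)) (Ordinal lt_jk)).
rewrite !mxE => <-; apply/eqP; congr (M _ _); apply/val_inj => //=.
by rewrite subnKC.
Qed.

Lemma flag_rank_gt1 M i j : i != j ->
  flag_submx M i != 0 -> flag_submx M j != 0 -> (1 < flag_rank M)%N.
Proof.
move=> neq_ij; rewrite -!mxrank_eq0 -!lt0n => Mi Mj.
rewrite /flag_rank (bigD1 i) //= (bigD1 j) 1?eq_sym //= addnA.
by apply: leq_trans (leq_addr _ _); apply: (leq_add Mi Mj).
Qed.

(** Position [(i, i)] belongs to the [i]-th block only, and there the matrix is a column times a
    row. *)
Lemma flag_rank_scale_delta (c : F) i : (flag_rank (c *: delta_mx i i) <= 1)%N.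
Proof.
rewrite /flag_rank (bigD1 i) //= big1 ?addn0.
  rewrite -(mul_delta_mx (0 : 'I_1)) scalemxAl /flag_submx mxsub_mul.
  by rewrite (leq_trans (mxrankM_maxr _ _)) ?rank_leq_row.
move=> k neq_ki; apply/eqP; rewrite mxrank_eq0; apply/eqP/matrixP=> a b.
rewrite !mxE; case: eqP => [ai|]; last by rewrite mulr0.
case: eqP => [bi|]; last by rewrite mulr0.
(* Row [a] of block [k] gives [i <= k], and column [k + b = i] gives [k <= i]. *)
case/eqP: neq_ki; apply/val_inj/eqP; rewrite /= eqn_leq.
have /= aE := congr1 val ai; have /= bE := congr1 val bi.
by rewrite -[X in (_ <= X)%N && _]bE leq_addr -aE -ltnS ltn_ord.
Qed.

Lemma flag_rank_le1_delta M : upper_trig M -> (flag_rank M <= 1)%N ->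
  M != 0 -> exists i, M = M i i *: delta_mx i i.
Proof.
move=> /is_trig_mxP Mtrig frM nzM.
(* The first entry makes block [i] nonzero and the second makes block [l] nonzero; two distinct
   nonzero blocks would already give weight 2. *)
have on_diag i j k l : M i j != 0 -> M k l != 0 -> i = l.
  have le_ij a b : M a b != 0 -> (a <= b)%N.
    by apply: contraNT; rewrite -ltnNge => /Mtrig; rewrite mxE => ->.
  move=> Mij Mkl; apply: contraTeq frM => neq_il; rewrite -ltnNge.
  apply: (flag_rank_gt1 _ _ _ neq_il).
    exact: flag_submx_neq0 Mij _ (le_ij _ _ Mij).
  exact: flag_submx_neq0 Mkl (le_ij _ _ Mkl) _.
have /existsP[i /existsP[j nzMij]] : [exists i, exists j, M i j != 0].
  apply: contraNT nzM => /existsPn-M0.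
  apply/eqP/matrixP=> i j; rewrite mxE; apply/eqP/negPn.
  by apply: contra (M0 i) => ?; apply/existsP; exists j.
(* Used twice on the same entry, [on_diag] puts it on the diagonal; below, it is compared with any
   other nonzero entry. *)
have eq_ij := on_diag _ _ _ _ nzMij nzMij; rewrite -eq_ij in nzMij.
exists i; apply/matrixP=> a b; rewrite !mxE.
case: eqVneq => [->|neq_ai]; last first.
  rewrite mulr0; apply/eqP; apply: contraNT neq_ai => nzab.
  by rewrite (on_diag _ _ _ _ nzab nzMij).
case: eqVneq => [->|neq_bi]; first by rewrite mulr1.
rewrite mulr0; apply/eqP; apply: contraNT neq_bi => nzab.
by rewrite eq_sym (on_diag _ _ _ _ nzMij nzab).
Qed.

Lemma fr_ball_card1 : fr_ball_card F n 1 = (1 + n * (#|F| - 1))%N.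
Proof.
pose mono (p : 'I_n * F) := p.2 *: delta_mx p.1 p.1 : 'M[F]_n.
pose nz := [set p : 'I_n * F | p.2 != 0].
have mono_diag p : mono p p.1 p.1 = p.2 by rewrite !mxE eqxx mulr1.
have mono_neq0 p : p \in nz -> mono p != 0.
  rewrite inE; apply: contraNneq => /matrixP/(_ p.1 p.1).
  by rewrite mono_diag mxE => ->.
(* The restriction to [nz] matters: every pair [(i, 0)] is sent to the zero matrix, which is counted
   separately. *)
have mono_inj : {in nz &, injective mono}.
  move=> [i c] [j d]; rewrite inE /= => nzc _ eq_m.
  have := mono_diag (i, c); rewrite eq_m !mxE /= andbb.
  case: eqP => [->|_]; first by rewrite mulr1 => ->.
  by rewrite mulr0 => c0; rewrite -c0 eqxx in nzc.
rewrite /fr_ball_card.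
have -> : [set A : 'M[F]_n | upper_trig A & (flag_rank A <= 1)%N]
            = 0 |: mono @: nz.
  apply/setP=> A; rewrite inE in_setU1; apply/idP/idP.
    case/andP=> trA frA; case: eqVneq => //= nzA.
    have [i eqA] := flag_rank_le1_delta A trA frA nzA.
    apply/imsetP; exists (i, A i i) => //; rewrite inE /=.
    by apply: contraNneq nzA => Aii0; rewrite eqA Aii0 scale0r.
  have tr_mono p : upper_trig (mono p) && (flag_rank (mono p) <= 1)%N.
    rewrite flag_rank_scale_delta andbT; apply/is_trig_mxP=> i j lt_ij.
    rewrite !mxE; case: eqP => [jp|]; last by rewrite mulr0.
    case: eqP => [ip|]; last by rewrite mulr0.
    by rewrite jp ip ltnn in lt_ij.
  case/predU1P=> [->|/imsetP[p _ ->]] //.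
  rewrite /upper_trig trmx0 (_ : is_trig_mx 0); last first.
    by apply/is_trig_mxP=> i j _; rewrite mxE.
  rewrite /flag_rank big1 // => i _.
  by apply/eqP; rewrite mxrank_eq0; apply/eqP/matrixP=> a b; rewrite !mxE.
rewrite cardsU1 card_in_imset //.
have -> : 0 \notin mono @: nz.
  by apply/imsetP=> -[p /mono_neq0]; rewrite eq_sym => /eqP.
have -> : nz = setX setT [set~ 0] by apply/setP=> p; rewrite !inE.
by rewrite cardsX cardsT card_ord cardsC1 subn1.
Qed.

End FlagRankBall.

Section Singleton3.

Local Open Scope ring_scope.

(** The two floors are those of [sqrt 2] and [(sqrt 9 - 1) / 2 = 1], both equal to 1, so the bound
    is [3 - 1 + 1 * 1]. *)
Lemma singleton_bound3 : singleton_bound 3 = 3.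
Proof.
have two : 3%:R - 1 = 2 :> algC by apply/eqP; rewrite subr_eq natr1.
have nine : 4 * 2 + 1 = 3 ^+ 2 :> algC by rewrite -natrM -natrX natr1.
rewrite /singleton_bound two nine sqrCK ?ler0n // two divff ?pnatr_eq0 //.
rewrite floor1 (@floor_def _ _ 1) //.
(* Writing the bounds 1 and 2 as square roots of 1 and [2 ^+ 2] reduces [1 <= sqrt 2 < 2] to
   comparing radicands. *)
rewrite -[1%:~R]sqrtC1 -[X in _ < X](@sqrCK _ (1 + 1)%:~R) ?ler0n //.
rewrite ler_sqrtC ?ltr_sqrtC ?qualifE /= ?exprn_ge0 ?ler0n ?ler1n //.
by rewrite -natrX ltr_nat.
Qed.

End Singleton3.

Theorem corollary5p5 (F : finFieldType) (n : nat) (C : {vspace 'M[F]_n}) :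
  MFRD C -> min_distance C 3 ->
  n = (#|F| ^ 3 - 1) %/ (#|F| - 1) ->
  perfect C.
Proof.
move=> [frC [d [[M [MC nzM frM]] minC] codimC]] dC3 nE.
(* The distance hidden in [MFRD] is existential; each minimum is attained, so each bounds the
   other. *)
have d3 : d = 3.
  have [[M3 [M3C nzM3 frM3]] minC3] := dC3.
  by apply/eqP; rewrite eqn_leq -{1}frM3 minC // -frM minC3.
(* The packing radius [(3 - 1) %/ 2] computes to 1. *)
split=> //; exists 3 => //; rewrite fr_ball_card1 card_vspace.
have -> : dimU n = \dim C + 3.
  apply/eqP; rewrite -eqz_nat PoszD addrC -subr_eq.
  by apply/eqP; rewrite -[LHS]/(codim C) codimC d3 singleton_bound3.
have q_gt0 : 0 < #|F| ^ 3 by rewrite expn_gt0 (ltnW (finNzRing_gt1 F)).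
rewrite expnD; congr (_ * _).
(* The division defining [n] is exact since [q - 1] divides [q ^ 3 - 1], so the ball has
   [1 + (q ^ 3 - 1)] elements. *)
by rewrite nE divnK ?subnKC // !subn1 dvdn_pred_predX.
Qed.
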